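(* Consider a sequence $(\mathcal{T}_n)_{n=1}^\infty$ of random finite unlabeled rooted trees that converges in the probability fringe sense to a sin-tree $\mathcal{T} = (\mathcal{T}^0, \mathcal{T}^1, \ldots)$. Suppose for some pair $\mathbf{t}_1, \mathbf{t}_2$ of finite unlabeled rooted trees with the exchange property that $\mathbb{P}\{\mathcal{T}^0 = \mathbf{t}_1\} > 0$. Then \[ \lim_{n \to \infty} \mathbb{P}\{\mathcal{T}_n \text{ shares its spectrum with another tree}\} = 1 . \]
   Context: Let $\mathbb{T}$ be the countable set of all finite unlabeled rooted trees (isomorphism classes of finite rooted trees, where isomorphisms preserve the root), with the discrete topology. Let $\mathbb{T}_\ast = \mathbb{T} \sqcup \{\ast\}$, where $\ast$ is an adjoined point, with the discrete topology, and give $\mathbb{T}^\infty$ and $\mathbb{T}_\ast^\infty$ the product topologies. For $\mathbf{t} \in \mathbb{T}$ with root $\rho$ and a vertex $v$ at distance $h \ge 0$ from the root, let $(v = v_0, v_1, \ldots, v_h = \rho)$ be the path from $v$ to the root. Let $t_0$ be the subtree rooted at $v_0$ consisting of all vertices whose path to the root passes through $v_0$ and, for $1 \le k \le h$, let $t_k$ be the subtree rooted at $v_k$ consisting of all vertices whose path to the root passes through $v_k$ but not through $v_{k-1}$. Let $\Phi(\mathbf{t}, \cdot)$ be the probability measure on $\mathbb{T}_\ast^\infty$ that places mass $(\#\mathbf{t})^{-1}$ at each of the sequences $(t_0, t_1, \ldots, t_h, \ast, \ast, \ldots)$ as $v$ ranges over the $\#\mathbf{t}$ vertices of $\mathbf{t}$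 (masses are added in case of coincidences). A sequence $(\mathcal{T}_n)$ of random elements of $\mathbb{T}$ converges in the probability fringe sense to a $\mathbb{T}^\infty$-valued random variable $\mathcal{T}$ if the random probability measures $\Phi(\mathcal{T}_n, \cdot)$ on $\mathbb{T}_\ast^\infty$ converge in distribution, in the topology of weak convergence of probability measures on $\mathbb{T}_\ast^\infty$, to the (deterministic) distribution of $\mathcal{T}$. Elements of $\mathbb{T}^\infty$ are called sin-trees. Exchange property: a pair of non-isomorphic finite rooted trees $\mathbf{t}_1, \mathbf{t}_2$ with the same number of vertices has the exchange property if, whenever $\mathbf{t}'$ is a finite rooted tree with $\mathbf{t}_1$ as a subtree (that is, for some vertex $v$ of $\mathbf{t}'$ the subtree consisting of $v$ and all vertices below it, rooted at $v$, is isomorphic to $\mathbf{t}_1$), replacing this $\mathbf{t}_1$ by $\mathbf{t}_2$ (with the root of $\mathbf{t}_2$ taking the place of $v$) produces a tree $\mathbf{t}''$ whose adjacency matrix has the same spectrum (eigenvalues with multiplicities) as that of $\mathbf{t}'$. ''$\mathcal{T}_n$ shares its spectrum with another tree'' means that there is a tree not isomorphic (as a graph) to $\mathcal{T}_n$ whose adjacency matrix has the same eigenvalues, with multiplicities, as the adjacency matrix of $\mathcal{T}_n$. *)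

(* Defs.v *)
From HB Require Import structures.
From mathcomp Require Import all_boot all_order all_algebra algC.
From mathcomp Require Import all_classical all_reals all_analysis.

Set Implicit Arguments.
Unset Strict Implicit.
Unset Printing Implicit Defensive.

Import Order.TTheory GRing.Theory Num.Theory.
Import numFieldNormedType.Exports.

Local Open Scope classical_set_scope.
Local Open Scope quotient_scope.
Local Open Scope ring_scope.

Section graphs.
Variable V : finType.
Implicit Types (e : rel V) (u v r : V) (p : seq V).

(* The vertices of the path are u :: p. *)
Definition simple_path e u v p : Prop :=
  [/\ path e u p, uniq (u :: p) & last u p = v].

Definition is_tree e : Prop :=
  [/\ (0 < #|V|)%N, symmetric e, irreflexive e &
      forall u v, exists! p, simple_path e u v p].

Definition root_path e r u : seq V := xget [::] [set p | simple_path e u r p].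

(* The sequence (v_0 = u, v_1, ..., v_h = r). *)
Definition lineage e r u : seq V := u :: root_path e r u.

Definition depth e r u : nat := size (root_path e r u).

Definition ancestor e r u (k : nat) : V := nth r (lineage e r u) k.

Definition below e r v : {set V} := [set u | v \in lineage e r u].

(* For v_k := ancestor e r v k, the vertices of the tree t_k. *)
Definition fringe_set e r v (k : nat) : {set V} :=
  if k is j.+1 then below e r (ancestor e r v j.+1) :\: below e r (ancestor e r v j)
  else below e r (ancestor e r v 0).

Definition induced e (S : {set V}) : rel {x : V | x \in S} :=
  fun x y => e (val x) (val y).

End graphs.

Section isomorphisms.
Variables (V1 V2 : finType).

Definition graph_iso (e1 : rel V1) (e2 : rel V2) : Prop :=
  exists2 f : V1 -> V2, bijective f & forall x y, e2 (f x) (f y) = e1 x y.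

Definition rooted_iso (e1 : rel V1) (r1 : V1) (e2 : rel V2) (r2 : V2) : Prop :=
  exists f : V1 -> V2,
    [/\ bijective f, forall x y, e2 (f x) (f y) = e1 x y & f r1 = r2].

End isomorphisms.

Section tree_theory.
Variables (V : finType) (e : rel V).
Hypothesis te : is_tree e.

Lemma simple_path_root_path r u : simple_path e u r (root_path e r u).
Proof.
have [_ _ _ /(_ u r)[p [sp _]]] := te.
exact: (xgetPex [::] (ex_intro _ p sp)).
Qed.

Lemma root_pathE r u p : simple_path e u r p -> root_path e r u = p.
Proof.
move=> sp; have [_ _ _ /(_ u r)[q [_ uq]]] := te.
by rewrite -(uq _ sp) -(uq _ (simple_path_root_path r u)).
Qed.

Lemma lineage_suffix r u p1 p2 x : root_path e r u = p1 ++ x :: p2 ->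
  root_path e r x = p2.
Proof.
move=> E; apply: root_pathE.
have := simple_path_root_path r u; rewrite E => -[].
rewrite cat_path last_cat /= => /and3P[_ _ ?] /andP[_].
by rewrite cat_uniq => /and3P[_ _ ?] ?; split.
Qed.

Lemma size_lineage r u : size (lineage e r u) = (depth e r u).+1.
Proof. by []. Qed.

Lemma ancestor_lineage r v k : (k <= depth e r v)%N ->
  lineage e r (ancestor e r v k) = drop k (lineage e r v).
Proof.
move=> kd; rewrite [RHS](drop_nth r) // /lineage; congr cons.
rewrite /ancestor; case: k kd => [|k] kd /=; first by rewrite drop0.
by apply: (@lineage_suffix r v (take k (root_path e r v))); rewrite -drop_nth // cat_take_drop.
Qed.

Lemma uniq_lineage r v : uniq (lineage e r v).
Proof. by have [] := simple_path_root_path r v. Qed.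

Lemma fringe_root r v k : (k <= depth e r v)%N ->
  ancestor e r v k \in fringe_set e r v k.
Proof.
case: k => [|k] kd; first by rewrite /fringe_set /below finset.in_set mem_head.
rewrite /fringe_set /below finset.in_setD !finset.in_set mem_head andbT ancestor_lineage //.
have := uniq_lineage r v.
rewrite -{1}(cat_take_drop k.+1 (lineage e r v)) cat_uniq => /and3P[_ + _].
move=> /hasPn /= H; apply/negP => /H; apply/negP; rewrite negbK.
rewrite /ancestor -(@nth_take k.+1) //; apply: mem_nth.
by rewrite size_take size_lineage ltnS kd.
Qed.

Lemma fringe_set_lineage r v k u p1 x p2 :
  ancestor e r v k \in x :: p2 -> u \in fringe_set e r v k ->
  lineage e r u = p1 ++ x :: p2 -> x \in fringe_set e r v k.
Proof.
move=> ax uS E.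
have lx : lineage e r x = x :: p2.
  rewrite /lineage; congr cons; case: p1 E => [|z p1] [] //; first by move=> <- <-.
  by move=> _; apply: lineage_suffix.
case: k ax uS => [|k] ax; rewrite /fringe_set /below ?finset.in_setD !finset.in_set lx ?E //.
by rewrite mem_cat negb_or => /andP[/andP[_ ->]].
Qed.

Lemma fringe_path r v k u : u \in fringe_set e r v k ->
  exists p, [/\ path e u p, last u p = ancestor e r v k &
                all (mem (fringe_set e r v k)) (u :: p)].
Proof.
move=> uS.
have : ancestor e r v k \in lineage e r u by case: k uS => [|k]; rewrite /fringe_set /below ?finset.in_setD !finset.in_set // => /andP[].
case/(nthP r) => i; rewrite size_lineage ltnS => id ai.
pose p := take i (root_path e r u).
have sp : size p = i by rewrite size_take; move: id; rewrite leq_eqVlt => /orP[/eqP ->|->] //; rewrite ltnn.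
have [up _ _] := simple_path_root_path r u.
exists p; split.
- by move: up; rewrite -(cat_take_drop i (root_path e r u)) cat_path => /andP[].
- rewrite -ai; case: i id ai @p sp => [|i] id ai p sp; first by rewrite /p take0.
  rewrite -nth_last sp /= nth_take //; exact: set_nth_default.
apply/allP => x; change (u :: p) with (take i.+1 (lineage e r u)).
move=> /(nthP r)[j]; rewrite size_take size_lineage.
have ji : (if (i.+1 < (depth e r u).+1)%N then i.+1 else (depth e r u).+1) = i.+1.
  by case: ltnP => // h; apply/eqP; rewrite eqn_leq h ltnS.
rewrite ji => jli; rewrite nth_take // => xj.
apply: (@fringe_set_lineage _ _ _ u (take j (lineage e r u)) x (drop j.+1 (lineage e r u))) => //.
  rewrite -ai -xj -drop_nth; last by rewrite size_lineage; apply: leq_trans jli _.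
  rewrite -(subnKC (_ : j <= i)%N) // -nth_drop mem_nth // size_drop size_lineage.
  by rewrite ltn_sub2r // ltnS // (leq_trans _ id).
by rewrite -xj -drop_nth ?cat_take_drop // size_lineage; apply: leq_trans jli _.
Qed.

Lemma induced_path (S : {set V}) (x : {x : V | x \in S}) (p : seq V) :
  path e (val x) p -> all (mem S) p ->
  exists q : seq {x : V | x \in S}, path (induced e (S:=S)) x q /\ map val q = p.
Proof.
elim: p x => [|y p IH] x /=; first by exists [::].
move=> /andP[exy yp] /andP[yS pS].
have [q [pq qE]] := IH (Sub y yS) yp pS.
by exists (Sub y yS :: q); rewrite /= pq andbT qE; split.
Qed.

Lemma fringe_is_tree r v k : (k <= depth e r v)%N ->
  is_tree (induced e (S := fringe_set e r v k)).
Proof.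
move=> kd; have rS := fringe_root kd.
have [_ se ie ue] := te.
set S := fringe_set e r v k in rS *.
pose rt : {x : V | x \in S} := exist (fun x => is_true (x \in S)) _ rS.
have sI : symmetric (induced e (S:=S)) by move=> x y; apply: se.
split=> //.
- by apply/card_gt0P; exists rt.
- by move=> x; apply: ie.
have toroot (u : {x : V | x \in S}) :
    connect (induced e (S:=S)) u rt.
  have [p [up lp /andP[_ aS]]] := fringe_path (valP u).
  have [q [pq qE]] := induced_path up aS.
  apply/connectP; exists q => //; apply: val_inj.
  by rewrite -last_map qE lp.
move=> u w.
have : connect (induced e (S:=S)) u w.
  apply: connect_trans (toroot u) _.
  by rewrite (sym_connect_sym sI).
case/connectP => p0 /shortenP[p up uqp _] ->.
exists p; split=> // q [uq uqq lq].
apply: (inj_map (val_inj : injective (val : {x : V | x \in S} -> V))).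
have [p' [_ up']] := ue (val u) (val (last u p)).
have valsp (s : seq {x : V | x \in S}) : path (induced e (S:=S)) u s -> uniq (u :: s) ->
    last u s = last u p -> simple_path e (val u) (val (last u p)) (map val s).
  move=> us uqs ls; split; first by rewrite path_map.
    by rewrite -map_cons (map_inj_uniq val_inj).
  by rewrite last_map ls.
by rewrite -(up' _ (valsp _ up uqp erefl)) -(up' _ (valsp _ uq uqq lq)).
Qed.

End tree_theory.

(* adj is not given type rel 'I_nvert: the universe of rel would prevent ltree
   from being an eqType. *)
Record ltree := LTree {
  nvert : nat;
  adj : 'I_nvert -> 'I_nvert -> bool;
  root : 'I_nvert;
  adj_tree : is_tree adj }.

Lemma relabel_tree (V : finType) (e : rel V) : is_tree e ->
  is_tree (fun i j : 'I_#|V| => e (enum_val i) (enum_val j)).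
Proof.
move=> [V0 se ie ue]; split=> //; first by rewrite card_ord.
move=> i j; have [p [[ip uip lp] up]] := ue (enum_val i) (enum_val j).
have enumK : cancel (@enum_rank V) enum_val by move=> x; exact: enum_rankK.
have pE : map enum_val (map (@enum_rank V) p) = p by apply: mapK.
exists (map (@enum_rank V) p); split.
  split.
  - by move: ip; rewrite -{1}pE path_map.
  - by rewrite -(map_inj_uniq enum_val_inj) /= pE.
  - by apply: enum_val_inj; rewrite -last_map pE.
move=> q [iq uiq lq]; apply: (inj_map enum_val_inj); rewrite pE; apply: up; split.
- by rewrite path_map.
- by rewrite -map_cons (map_inj_uniq enum_val_inj).
- by rewrite last_map lq.
Qed.

Definition ltree_of (V : finType) (e : rel V) (r : V) (te : is_tree e) : ltree :=
  LTree (enum_rank r) (relabel_tree te).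

HB.instance Definition _ := gen_eqMixin ltree.
HB.instance Definition _ := gen_choiceMixin ltree.

Definition ltree_iso : rel ltree := fun s t =>
  `[< rooted_iso (@adj s) (root s) (@adj t) (root t) >].

Lemma ltree_iso_refl : reflexive ltree_iso.
Proof. by move=> t; apply/asboolP; exists id; split=> //; exists id. Qed.

Lemma ltree_iso_sym : symmetric ltree_iso.
Proof.
suff H s t : ltree_iso s t -> ltree_iso t s by move=> s t; apply/idP/idP; apply: H.
move=> /asboolP[f [[g fK gK] fe fr]]; apply/asboolP; exists g; split.
- by exists f.
- by move=> x y; rewrite -fe !gK.
- by rewrite -fr fK.
Qed.

Lemma ltree_iso_trans : transitive ltree_iso.
Proof.
move=> t s u /asboolP[f [bf fe fr]] /asboolP[g [bg ge gr]].
apply/asboolP; exists (g \o f); split; first exact: bij_comp.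
- by move=> x y; rewrite /= ge fe.
- by rewrite /= fr gr.
Qed.

Canonical ltree_equiv :=
  EquivRel ltree_iso ltree_iso_refl ltree_iso_sym ltree_iso_trans.
Canonical ltree_encModRel := defaultEncModRel ltree_iso.

Definition rtree : Type := {eq_quot ltree_iso}.

HB.instance Definition _ := Choice.on rtree.

Definition iso_class (t : ltree) : rtree := \pi_({eq_quot ltree_iso}) t.

Definition rep (t : rtree) : ltree := repr (t : {eq_quot ltree_iso}).

Lemma one_vertex_tree : is_tree (fun _ _ : 'I_1 => false).
Proof.
split=> //; first by rewrite card_ord.
move=> u v; exists [::]; split; first by rewrite [v]ord1 [u]ord1.
by move=> [|a p] // [].
Qed.

HB.instance Definition _ :=
  isPointed.Build rtree (iso_class (LTree ord0 one_vertex_tree)).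
HB.instance Definition _ := hasNbhs.Build rtree principal_filter.
HB.instance Definition _ := Discrete_ofNbhs.Build rtree erefl.

(* rtree with an adjoined point None. *)
Definition rtree_star : Type := option rtree.

HB.instance Definition _ := Choice.on rtree_star.
HB.instance Definition _ := isPointed.Build rtree_star None.
HB.instance Definition _ := hasNbhs.Build rtree_star principal_filter.
HB.instance Definition _ := Discrete_ofNbhs.Build rtree_star erefl.

Definition sin_tree : Type := prod_topology (fun _ : nat => rtree).
HB.instance Definition _ := Topological.on sin_tree.
HB.instance Definition _ := isPointed.Build sin_tree (fun=> point).

Definition star_seq : Type := prod_topology (fun _ : nat => rtree_star).
HB.instance Definition _ := Topological.on star_seq.
HB.instance Definition _ := isPointed.Build star_seq (fun=> point).

Notation borel X := (g_sigma_algebraType (@open X)).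

Definition num_vertices (t : rtree) : nat := nvert (rep t).

Section fringe.
Variables (t : ltree) (v : 'I_(nvert t)).

Definition fringe_tree (k : 'I_(depth (@adj t) (root t) v).+1) : rtree :=
  iso_class (ltree_of (exist (fun x => is_true (x \in fringe_set _ _ _ _)) _ (fringe_root (adj_tree t) (ltn_ord k)))
                      (fringe_is_tree (adj_tree t) (ltn_ord k))).

Definition subtree_at : rtree := fringe_tree ord0.

(* The sequence (t_0, t_1, ..., t_h, *, *, ...). *)
Definition fringe_seq : star_seq := fun k => omap fringe_tree (insub k).

End fringe.

Section Phi.
Variables (R : realType) (t : rtree).
Local Open Scope ereal_scope.

Definition Phi (A : set (borel star_seq)) : \bar R :=
  ((num_vertices t)%:R^-1)%:E *
  \sum_(v < num_vertices t) \d_(fringe_seq v : borel star_seq) A.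

Let diracs (i : nat) : {measure set (borel star_seq) -> \bar R} :=
  \d_(fringe_seq (insubd (root (rep t)) i) : borel star_seq).

Let Phi_mscale :
  Phi = mscale (((num_vertices t)%:R^-1)%:nng)%R (msum diracs (num_vertices t)).
Proof.
apply/funext => A; rewrite /Phi /mscale /msum /=; congr (_ * _).
by apply: eq_bigr => v _; rewrite /diracs valKd.
Qed.

Let Phi0 : Phi set0 = 0.
Proof. by rewrite Phi_mscale measure0. Qed.

Let Phi_ge0 A : 0 <= Phi A.
Proof. by rewrite Phi_mscale measure_ge0. Qed.

Let Phi_sigma_additive : semi_sigma_additive Phi.
Proof. by rewrite Phi_mscale; exact: measure_semi_sigma_additive. Qed.

HB.instance Definition _ :=
  isMeasure.Build _ _ _ Phi Phi0 Phi_ge0 Phi_sigma_additive.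

Let Phi_setT : Phi [set: _] = 1.
Proof.
rewrite /Phi (eq_bigr (fun=> 1%:E)); last by move=> v _; rewrite diracT.
rewrite sumEFin -EFinM big_const_ord iter_addr_0 mulVf //.
by rewrite pnatr_eq0 -lt0n (leq_trans _ (ltn_ord (root (rep t)))).
Qed.

HB.instance Definition _ := Measure_isProbability.Build _ _ _ Phi Phi_setT.

End Phi.

Section embedding.

Definition sin_embed (s : sin_tree) : star_seq := fun k => Some (s k).

Lemma continuous_sin_embed : continuous sin_embed.
Proof.
move=> s; apply/cvg_sup => i A [_ [[B _ <-] Bs] BA].
have pc : continuous (fun f : sin_tree => f i : rtree).
  exact: (@proj_continuous nat (fun=> rtree) i).
have : nbhs (s i : rtree) [set s i].
  by rewrite nbhs_principalE; apply/principal_filterP.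
move/(pc s); rewrite !nbhs_simpl /=; apply: (@filterS _ (nbhs s)) => f /= fi; apply: BA.
by move: Bs; rewrite /sin_embed /= fi.
Qed.

Definition borel_sin_embed : borel sin_tree -> borel star_seq := sin_embed.

Lemma measurable_sin_embed : measurable_fun [set: borel sin_tree] borel_sin_embed.
Proof.
apply: (@measurability _ _ (borel sin_tree) (borel star_seq) setT _ (@open star_seq)) => // _ [A oA <-].
rewrite setTI; apply: sub_sigma_algebra.
by have /continuousP := continuous_sin_embed; apply.
Qed.

HB.instance Definition _ := isMeasurableFun.Build _ _ (borel sin_tree) (borel star_seq)
  borel_sin_embed measurable_sin_embed.

(* The law of X, seen as a probability measure on star_seq. *)
Definition sin_law (R : realType) (d : measure_display) (Omega : measurableType d)
    (P : probability Omega R) (X : {RV P >-> borel sin_tree}) :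
    probability (borel star_seq) R :=
  distribution P (borel_sin_embed \o X).

End embedding.

Section weak_convergence.
Variables (R : realType) (S : ptopologicalType).

Definition test_function : Type :=
  {f : S -> R | continuous f /\ bounded_fun f}.

Definition integrate (mu : probability (borel S) R) :
    prod_topology (fun _ : test_function => R) :=
  fun f => (\int[mu]_x sval f x)%R.

(* The probability measures on S with the topology of weak convergence: the
   coarsest one making every mu |-> \int f dmu continuous, for f bounded and
   continuous. *)
Definition weak_probability : Type := initial_topology integrate.
HB.instance Definition _ := Topological.on weak_probability.

End weak_convergence.

(* Convergence in distribution of the Y-valued random elements M n (each on its
   own probability space) to the constant y; the law of the limit is the point
   mass at y, so the limiting expectation is F y. *)
Definition cvg_in_distribution_to (R : realType) (Y : topologicalType)
    (d : nat -> measure_display) (Omega : forall n, measurableType (d n))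
    (P : forall n, probability (Omega n) R) (M : forall n, Omega n -> Y) (y : Y) :
    Prop :=
  forall F : Y -> R, continuous F -> bounded_fun F ->
    (fun n => (\int[P n]_w F (M n w))%R) @ \oo --> F y.

Definition fringe_cvg (R : realType)
    (d : nat -> measure_display) (Omega : forall n, measurableType (d n))
    (P : forall n, probability (Omega n) R) (T : forall n, {RV P n >-> borel rtree})
    (d' : measure_display) (Omega' : measurableType d') (P' : probability Omega' R)
    (X : {RV P' >-> borel sin_tree}) : Prop :=
  @cvg_in_distribution_to R (weak_probability R star_seq) d Omega P
    (fun n w => (Phi R (T n w) : probability (borel star_seq) R))
    (sin_law X).

Definition adjacency (n : nat) (e : rel 'I_n) : 'M[algC]_n :=
  \matrix_(i, j) (e i j)%:R.

(* All eigenvalues are real; algC makes the spectrum complete by construction. *)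
Definition cospectral (m n : nat) (A : 'M[algC]_m) (B : 'M[algC]_n) : Prop :=
  forall a : algC, mup a (char_poly A) = mup a (char_poly B).

(* t'' is obtained from t' by replacing the subtree t1 at some vertex v by t2:
   f identifies what is left of t' once everything strictly below v is removed
   with what is left of t'' once everything strictly below w is removed. *)
Definition replacement (t1 t2 : rtree) (t' t'' : ltree) : Prop :=
  exists (v : 'I_(nvert t')) (w : 'I_(nvert t'')) (f : 'I_(nvert t') -> 'I_(nvert t'')),
    let A := v |: ~: below (@adj t') (root t') v in
    let B := w |: ~: below (@adj t'') (root t'') w in
    [/\ subtree_at v = t1, subtree_at w = t2, f v = w & f (root t') = root t''] /\
    [/\ {in A &, injective f}, f @: A = B &
        {in A &, forall x y, adj (f x) (f y) = adj x y}].

Definition exchange_property (t1 t2 : rtree) : Prop :=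
  [/\ t1 <> t2, num_vertices t1 = num_vertices t2 &
      forall t' t'' : ltree, replacement t1 t2 t' t'' ->
        cospectral (adjacency (@adj t')) (adjacency (@adj t''))].

Definition shares_spectrum (t : rtree) : Prop :=
  exists (m : nat) (e : rel 'I_m),
    [/\ is_tree e, ~ graph_iso e (@adj (rep t)) &
        cospectral (adjacency e) (adjacency (@adj (rep t)))].

(* Main.v *)
(* Let N(t) be the number of vertices of t whose subtree is t1. Replacing a copy
   of t1 by t2 lowers N by exactly one, because #t1 = #t2 and t1 <> t2. Moving
   the root changes N by at most one: only the subtrees of the vertices between
   the two roots change, and these are nested, so at most one of them has the
   size of t1. If N(t) >= 2, two successive replacements thus give a cospectral
   tree that is not isomorphic to t, even as an unrooted graph.

   It remains to see that N(T_n) >= 2 with probability tending to 1. The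
   functional mu |-> mu(s_0 = t1) - mu(s_1 = None) is weakly continuous; it is
   positive at the law of T, and it is nonpositive at Phi(t, .) when N(t) <= 1,
   because then the atom of the root outweighs the atoms with s_0 = t1. *)
Require Import Defs.
From mathcomp Require Import all_boot all_order all_algebra.
From mathcomp Require Import perm.
From mathcomp Require Import all_classical all_reals all_analysis.

Set Implicit Arguments.
Unset Strict Implicit.
Unset Printing Implicit Defensive.

Import Order.TTheory GRing.Theory Num.Theory.
Import numFieldNormedType.Exports.
Local Open Scope classical_set_scope.
Local Open Scope ring_scope.

(** * Rooted trees as parent functions *)

Section parents.
Variables (V : finType) (e : rel V) (r : V).

(** Grafting is easy to describe by parents and awkward to describe by unique paths. The rank [d]
    may be any function that drops from a vertex to its parent, not only the depth: its role is to
    exclude cycles. *)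
Record parent_map (p : V -> V) (d : V -> nat) : Prop := ParentMap {
  parent_root : p r = r;
  parent_rank : forall x, x != r -> (d (p x) < d x)%N;
  parent_adj : forall x y,
    e x y = ((x != r) && (p x == y)) || ((y != r) && (p y == x)) }.

Lemma tree_parent_map : is_tree e -> exists p d, parent_map p d.
Proof.
move=> te; have [_ se ie ue] := te.
have lin0 : root_path e r r = [::] by apply: root_pathE.
have adjc x y : e x y -> y \notin lineage e r x -> root_path e r y = lineage e r x.
  move=> exy yx; apply: (root_pathE te); have [px ux lx] := simple_path_root_path te r x.
  by split=> //=; rewrite ?[e y x]se ?exy //; apply/andP; split.
have dlt x y : y \in lineage e r x -> x != y -> (depth e r y < depth e r x)%N.
  rewrite inE => /orP[/eqP-> /eqP//|]; rewrite -[y \in _]/(y \in root_path e r x).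
  move=> yx _; have [p1 [p2 E]] : exists p1 p2, root_path e r x = p1 ++ y :: p2.
    by case/path.splitPr: yx => p1 p2; exists p1, p2.
  by rewrite /depth (lineage_suffix te E) E size_cat /= addnS ltnS leq_addl.
(* The default [r] of [head] makes the root its own parent. *)
pose p x := head r (root_path e r x).
have pE x : x != r -> root_path e r x = lineage e r (p x).
  move=> xr; have [px ux lx] := simple_path_root_path te r x; rewrite /p.
  case E : (root_path e r x) px lx => [|y q] /=; first by move=> _ h; rewrite h eqxx in xr.
  by move=> _ _; rewrite /lineage (@lineage_suffix _ _ te r x [::] q y).
exists p, (depth e r); split.
- by rewrite /p lin0.
- by move=> x xr; rewrite /depth [X in (_ < size X)%N]pE.
move=> x y; apply/idP/idP.
  move=> exy; have xy : x != y by apply: contraL exy => /eqP->; rewrite ie.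
  (* Depth drops strictly along a lineage, so two adjacent vertices cannot each lie on the lineage
     of the other. The one that is missing from the other's lineage is the child. *)
  have [yx|yx] := boolP (y \in lineage e r x).
    have nxy : x \notin lineage e r y.
      apply/negP => xy'; have := dlt _ _ yx xy; rewrite ltnNge => /negP; apply.
      by apply/ltnW/dlt => //; rewrite eq_sym.
    rewrite se in exy; have E := adjc _ _ exy nxy.
    apply/orP; left; rewrite /p E eqxx andbT.
    by apply/eqP => xr; move: E; rewrite xr lin0.
  have E := adjc _ _ exy yx.
  apply/orP; right; rewrite /p E eqxx andbT.
  by apply/eqP => yr; move: E; rewrite yr lin0.
have H z : z != r -> e z (p z).
  by move=> zr; have [] := simple_path_root_path te r z; rewrite pE //= => /andP[].
by move=> /orP[] /andP[zr /eqP <-]; [|rewrite se]; apply: H.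
Qed.

Variables (p : V -> V) (d : V -> nat).
Hypothesis pm : parent_map p d.

Lemma parent_rank_le x : (d (p x) <= d x)%N.
Proof.
have [->|/(parent_rank pm)/ltnW//] := eqVneq x r.
by rewrite (parent_root pm).
Qed.

Lemma fconnect_rank x y : fconnect p x y -> (d y <= d x)%N.
Proof.
move=> /iter_findex <-; elim: (findex _ _ _) => //= n; apply: leq_trans.
exact: parent_rank_le.
Qed.

Lemma fconnect_parent x y : fconnect p x y = (x == y) || fconnect p (p x) y.
Proof.
apply/idP/orP => [/iter_findex <-|[/eqP ->//|]].
  by case: (findex _ _ _) => [|n]; [left|right; rewrite iterSr fconnect_iter].
by apply: connect_trans; apply: fconnect1.
Qed.

Lemma fconnect_parentF x : x != r -> fconnect p (p x) x = false.
Proof.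
move=> xr; apply/negP => /fconnect_rank; rewrite leqNgt.
by rewrite (parent_rank pm).
Qed.

Lemma fconnect_fromr x : fconnect p r x = (x == r).
Proof.
apply/idP/eqP => [/iter_findex <-|->//].
by elim: (findex _ _ _) => //= n ->; apply: parent_root pm.
Qed.

Lemma fconnect_root x : fconnect p x r.
Proof.
have [n] := ubnP (d x); elim: n x => // n IH x /ltnSE dx.
rewrite fconnect_parent; have [//|xr /=] := eqVneq x r.
by apply/IH/(leq_trans _ dx)/(parent_rank pm).
Qed.

Lemma parent_adj_sym : symmetric e.
Proof. by move=> x y; rewrite !(parent_adj pm) orbC. Qed.

Lemma adj_parent x : x != r -> e x (p x).
Proof. by move=> xr; rewrite (parent_adj pm) xr eqxx. Qed.

(** From here on, being below a vertex is handled as reachability under iteration of [p]. *)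
Lemma mem_lineage u v : is_tree e -> (v \in lineage e r u) = fconnect p u v.
Proof.
move=> te; have [n] := ubnP (d u); elim: n u v => // n IH u v /ltnSE du.
have [->|ur] := eqVneq u r.
  by rewrite fconnect_fromr /lineage (root_pathE te (p := [::])) ?inE.
have lE w : (w \in lineage e r (p u)) = fconnect p (p u) w.
  by apply/IH/(leq_trans _ du)/(parent_rank pm).
rewrite fconnect_parent -lE inE eq_sym; congr (_ || (v \in _)).
apply: (root_pathE te); have [qx ux lx] := simple_path_root_path te r (p u).
split=> //; first by rewrite /= adj_parent.
by rewrite -[uniq _]/((u \notin lineage e r (p u)) && uniq (lineage e r (p u)))
  lE fconnect_parentF.
Qed.

(** The only edge that enters the subtree at [z] from outside is the one from the parent of [z]. *)
Lemma adj_below x y z : e x y -> fconnect p y z -> ~~ fconnect p x z ->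
  y = z /\ p z = x.
Proof.
rewrite (parent_adj pm) => /orP[] /andP[_ /eqP E] yz xz.
  by rewrite fconnect_parent E yz orbT in xz.
by move: yz; rewrite fconnect_parent E (negPf xz) orbF => /eqP yz; rewrite -yz.
Qed.

Lemma path_below x q z : path e x q -> p z \notin x :: q ->
  fconnect p x z = fconnect p (last x q) z.
Proof.
elim: q x => //= y q IH x /andP[exy yq]; rewrite !inE !negb_or => /and3P[xz yz qz].
rewrite -IH ?inE ?negb_or ?yz //; apply/idP/idP => h; apply/negPn/negP => h'.
  by have [_ E] := adj_below (etrans (parent_adj_sym y x) exy) h h'; rewrite E eqxx in yz.
by have [_ E] := adj_below exy h h'; rewrite E eqxx in xz.
Qed.

(** Climbing to the root gives connectedness; uniqueness of simple paths comes from comparing their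
    first steps. *)
Lemma parent_map_tree : is_tree e.
Proof.
split; [by apply/card_gt0P; exists r|exact: parent_adj_sym| |].
  move=> x; rewrite (parent_adj pm) orbb; apply/negP => /andP[xr /eqP E].
  by have := parent_rank pm xr; rewrite E ltnn.
have toroot x : connect e x r.
  have [n] := ubnP (d x); elim: n x => // n IH x /ltnSE dx.
  have [->//|xr] := eqVneq x r; apply: connect_trans (connect1 (adj_parent xr)) _.
  by apply/IH/(leq_trans _ dx)/(parent_rank pm).
move=> u w.
have : connect e u w.
  by apply: connect_trans (toroot u) _; rewrite (sym_connect_sym parent_adj_sym).
case/connectP => q0 /shortenP[q uq uqq _ wE].
(* A simple path that descends from [x] to a child [y] never returns to [x], so its end [w] is below
   [y]. The other path avoids [x] after its first step too, so [z] is below [y], and an edge from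
   [x] into that subtree can only end at [y]. *)
have branch x y z q1 q2 : e x y -> y != p x ->
    simple_path e x w (y :: q1) -> simple_path e x w (z :: q2) -> y = z.
  move=> exy yx [pq1 uq1 /= l1] [pq2 uq2 /= l2].
  have [pyx yr] : p y = x /\ y != r.
    by move: exy; rewrite (parent_adj pm) [p x == y]eq_sym (negPf yx) andbF => /andP[? /eqP].
  move: pq1 uq1 pq2 uq2 => /= /andP[_ pq1] /andP[xq1 _] /andP[exz pq2] /andP[xq2 _].
  subst x.
  have := path_below pq1 xq1; rewrite connect0 l1 => yw.
  have := path_below pq2 xq2; rewrite l2 -yw => zy.
  by have [|-> //] := adj_below exz zy; rewrite fconnect_parentF.
have uniqp x q1 q2 : simple_path e x w q1 -> simple_path e x w q2 -> q1 = q2.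
  elim: q1 x q2 => [|y q1 IH] x [|z q2] //.
  - by move=> [_ _ /= <-] [_ /= /andP[+ _] l]; rewrite -l mem_last.
  - by move=> [_ /= /andP[+ _] l] [_ _ /= xw]; rewrite xw -l mem_last.
  move=> s1 s2; have E : y = z.
    have exy : e x y by case: s1 => /= /andP[].
    have exz : e x z by case: s2 => /= /andP[].
    have [yx|yx] := eqVneq y (p x); last exact: branch exy yx s1 s2.
    have [zx|zx] := eqVneq z (p x); first by rewrite yx zx.
    by apply/esym; apply: branch exz zx s2 s1.
  congr cons => //; apply: (IH y).
    by case: s1 => /= /andP[_ ?] /andP[_ ?] ?; split.
  by rewrite E; case: s2 => /= /andP[_ ?] /andP[_ ?] ?; split.
by exists q; split=> [|q']; [|apply: uniqp].
Qed.
End parents.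

Lemma fconnect_linear (V : finType) (p : V -> V) x y z :
  fconnect p x y -> fconnect p x z -> fconnect p y z || fconnect p z y.
Proof.
move=> /iter_findex <- /iter_findex <-; set m := findex _ _ _; set n := findex _ _ _.
by case/orP: (leq_total m n) => /subnK <-; rewrite iterD fconnect_iter ?orbT.
Qed.

Lemma mem_below (V : finType) (e : rel V) r v u :
  (u \in below e r v) = (v \in lineage e r u).
Proof. by rewrite /below finset.in_set. Qed.

(** * Copies of a fixed tree inside a tree, and change of root *)

Section branches.
Variable V : finType.
Implicit Types (e : rel V) (S : {set V}) (r v : V) (t : ltree).

(** An embedding with image [S] avoids subtypes and relabelling; [subtree_atP] relates it to
    [subtree_at]. *)
Definition branch e S v t : Prop := exists h : 'I_(nvert t) -> V,
  [/\ injective h, codom h =i S, h (Defs.root t) = v &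
      forall i j, e (h i) (h j) = adj i j].

Definition branches e r t : {set V} :=
  finset (fun v => `[< branch e (below e r v) v t >]).

Lemma card_branch e S v t : branch e S v t -> #|S| = nvert t.
Proof. by move=> [h [ih hS _ _]]; rewrite -(eq_card hS) card_codom // card_ord. Qed.

Lemma eq_branch e e' S v t : {in S &, e =2 e'} -> branch e S v t -> branch e' S v t.
Proof.
move=> ee' [h [ih hS hr ha]]; exists h; split=> // i j.
by rewrite -ha ee' // -hS codom_f.
Qed.

Lemma branchesP e r t v :
  reflect (branch e (below e r v) v t) (v \in branches e r t).
Proof. by rewrite finset.in_set; apply: asboolP. Qed.

(** Connectivity after deletion of [v] depends only on the components of [u] and [r], which is what
    makes [below_reroot] immediate. *)
Lemma lineage_avoid e r u v : is_tree e -> r != v -> u != v ->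
  (v \in lineage e r u) = ~~ connect [rel x y | [&& e x y, x != v & y != v]] u r.
Proof.
move=> te rv uv; have [pu uu lu] := simple_path_root_path te r u.
apply/idP/negP => [vu /connectP[q0 /shortenP[q uq uqq _ rE]]|vu].
  move: vu; rewrite /lineage (root_pathE te (p := q)) => [|].
    rewrite inE eq_sym (negPf uv) /= => vq.
    by case/path.splitPr: vq uq => q1 q2; rewrite cat_path /= eqxx /= !andbF.
  by split=> //; apply: sub_path uq => x y /= => /andP[].
apply/negPn/negP => vl; apply: vu; apply/connectP; exists (root_path e r u) => //.
rewrite /lineage in vl; move: (root_path e r u) pu vl {uu lu} => q.
elim: q u uv => //= y q IH u uv /andP[-> yq].
rewrite !inE !negb_or => /and3P[_ vy vq]; rewrite uv [y == v]eq_sym vy /=.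
by apply: IH; rewrite // 1?eq_sym // inE negb_or vy.
Qed.

Lemma below_reroot e r r' v : is_tree e -> r' \notin below e r v ->
  below e r' v = below e r v.
Proof.
move=> te; rewrite mem_below => r'v.
have r'v' : r' != v by apply: contraNneq r'v => ->; rewrite mem_head.
have rv : r != v.
  have [p [d pm]] := tree_parent_map r te.
  by apply: contraNneq r'v => <-; rewrite (mem_lineage pm) // (fconnect_root pm).
have [_ se _ _] := te.
have cs : connect_sym [rel x y | [&& e x y, x != v & y != v]].
  by apply: sym_connect_sym => x y /=; rewrite se [(y != v) && _]andbC.
move: r'v; rewrite lineage_avoid // negbK => r'r.
apply/setP => u; rewrite !mem_below; have [->|uv] := eqVneq u v.
  by rewrite !mem_head.
by rewrite !lineage_avoid // (same_connect_r cs r'r).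
Qed.

(* The branches that a change of root destroys lie on the path between the two
   roots; they are nested and of the same size, so there is at most one. *)
Lemma card_branches_reroot e r r' t : is_tree e ->
  (#|branches e r t| <= #|branches e r' t|.+1)%N.
Proof.
move=> te; have [p [d pm]] := tree_parent_map r te.
pose B := branches e r t.
have c1 : (#|[set v in B | r' \in below e r v]| <= 1)%N.
  apply/card_le1_eqP => v w; rewrite !finset.in_set.
  wlog : v w / fconnect p v w => [H vB wB|vw].
    have := vB; have := wB.
    rewrite !(mem_lineage pm) // => /andP[_ r'w] /andP[_ r'v].
    by case/orP: (fconnect_linear r'v r'w) => ?; [|apply/esym]; apply: H.
  move=> /andP[/asboolP/card_branch cv _] /andP[/asboolP/card_branch cw _].
  have sub : below e r v \subset below e r w.
    apply/fintype.subsetP => x; rewrite !mem_below !(mem_lineage pm) // => xv.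
    exact: connect_trans xv vw.
  have /eqP E : below e r v == below e r w by rewrite eqEcard sub cv cw leqnn.
  have wv : fconnect p w v.
    by rewrite -(mem_lineage pm) // -mem_below E mem_below mem_head.
  (* If [v] and [w] differed, each would be reachable from the other, a cycle of [p]; the root is
     treated apart because [p] fixes it. *)
  move: vw; rewrite (fconnect_parent p) => /orP[/eqP->//|pvw].
  have [vr|vr] := eqVneq v r; last first.
    by have := fconnect_parentF pm vr; rewrite (connect_trans pvw wv).
  by move: pvw; rewrite vr (parent_root pm) (fconnect_fromr pm) => /eqP.
rewrite -/B -(cardsID [set v | r' \in below e r v] B) -addn1 addnC leq_add //.
  apply: subset_leq_card; apply/fintype.subsetP => v; rewrite !finset.in_set => /andP[r'v vB].
  by rewrite (@below_reroot _ r) // mem_below.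
rewrite (leq_trans _ c1) //; apply: subset_leq_card; apply/fintype.subsetP => v.
by rewrite !finset.in_set.
Qed.

End branches.

Lemma lineage_iso (V1 V2 : finType) (e1 : rel V1) (e2 : rel V2) (f : V1 -> V2) r u :
  is_tree e1 -> is_tree e2 -> injective f -> (forall x y, e2 (f x) (f y) = e1 x y) ->
  lineage e2 (f r) (f u) = map f (lineage e1 r u).
Proof.
move=> te1 te2 fi fe; rewrite /lineage /=; congr cons; apply: (root_pathE te2).
have [pu uu lu] := simple_path_root_path te1 r u; split.
- by rewrite path_map (eq_path (e' := e1)).
- by rewrite -map_cons map_inj_uniq.
- by rewrite last_map lu.
Qed.

Lemma card_branches_iso (V1 V2 : finType) (e1 : rel V1) (e2 : rel V2) (f : V1 -> V2) r t :
  is_tree e1 -> is_tree e2 -> bijective f -> (forall x y, e2 (f x) (f y) = e1 x y) ->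
  (#|branches e1 r t| <= #|branches e2 (f r) t|)%N.
Proof.
move=> te1 te2 [g fK gK] fe; have fi := can_inj fK.
rewrite -(card_imset _ fi); apply: subset_leq_card; apply/fintype.subsetP => w /imsetP[v].
move=> /branchesP[h [ih hS hr ha]] -> {w}; apply/branchesP; exists (f \o h); split.
- exact: inj_comp.
- move=> y; have [x ->] : exists x, y = f x by exists (g y).
  rewrite mem_below (lineage_iso _ _ te1) // (mem_map fi) -mem_below -hS.
  apply/idP/idP => /codomP[i E]; apply/codomP; exists i; first exact: fi.
  by rewrite E.
- by rewrite /= hr.
- by move=> i j; rewrite /= fe.
Qed.

(** * Grafting another tree of the same size onto a vertex *)

Section grafting.
Variables (V : finType) (e : rel V) (r v : V) (s : ltree).
Hypotheses (te : is_tree e) (card_s : #|below e r v| = nvert s).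
Let S := below e r v.

(** Any bijection onto [S], corrected by a transposition that brings the root to [v], will do: the
    edges of [s] are transported along it afterwards. *)
Lemma rooted_enum : exists h : 'I_(nvert s) -> V,
  [/\ injective h, codom h =i S & h (Defs.root s) = v].
Proof.
pose h0 i := enum_val (cast_ord (esym card_s) i).
have h0S i : h0 i \in S by apply: enum_valP.
have h0i : injective h0 by move=> i j /enum_val_inj/cast_ord_inj.
have vS : v \in S by rewrite mem_below mem_head.
pose h i := tperm (h0 (Defs.root s)) v (h0 i).
have hi : injective h by move=> i j /perm_inj/h0i.
exists h; split=> //; last by rewrite /h tpermL.
apply/subset_cardP; first by rewrite card_codom // card_ord.
apply/fintype.subsetP => x /codomP[i ->]; rewrite /h.
by case: tpermP => [_|_|_ _].
Qed.

(* The vertices strictly below v get their parents from s through h; the rank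
   shift makes them deeper than v. *)
Lemma graft : exists e' : rel V,
  [/\ is_tree e', branch e' (below e' r v) v s,
      {in v |: ~: S &, e' =2 e},
      forall z, z \in v |: ~: S -> below e' r z = below e r z &
      forall z, z \in S :\ v -> below e' r z \proper S /\ below e r z \proper S].
Proof.
have [h [hi hS hr]] := rooted_enum.
have [p [d pm]] := tree_parent_map r te.
have [ps [ds pms]] := tree_parent_map (Defs.root s) (adj_tree s).
(* Only values on [S] matter; the default is arbitrary. *)
pose hinv x := odflt (Defs.root s) [pick i | h i == x].
have hK : cancel h hinv.
  move=> i; rewrite /hinv; case: pickP => [j /eqP/hi //|/(_ i)]; by rewrite eqxx.
have hinvK x : x \in S -> h (hinv x) = x.
  by rewrite -hS => /codomP[i ->]; rewrite hK.
have inS x : (x \in S) = fconnect p x v by rewrite mem_below (mem_lineage pm).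
have vS : v \in S by rewrite inS.
pose U := S :\ v.
have inU x : (x \in U) = (x != v) && (x \in S) by rewrite finset.in_setD1.
have nU x : (x \in v |: ~: S) = (x \notin U).
  by rewrite inU finset.in_setU1 finset.in_setC negb_and negbK.
have Ur x : x \in U -> x != r.
  rewrite inU inS => /andP[xv]; apply: contraTneq => xr.
  by rewrite xr (fconnect_fromr pm) -xr eq_sym.
have pU x : x != r -> x \notin U -> p x \notin S.
  move=> xr; rewrite inU negb_and negbK => /orP[/eqP xv|].
    by rewrite inS -xv (fconnect_parentF pm).
  by apply: contra; rewrite !inS; apply: connect_trans; apply: fconnect1.
pose p' x := if x \in U then h (ps (hinv x)) else p x.
pose d' x := if x \in U then ((d v).+1 + ds (hinv x))%N else d x.
pose e' x y := ((x != r) && (p' x == y)) || ((y != r) && (p' y == x)).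
have hU i : (h i \in U) = (i != Defs.root s).
  by rewrite inU -hr (inj_eq hi) -hS codom_f andbT.
have hinvU x : x \in U -> hinv x != Defs.root s.
  by move=> xU; rewrite -hU hinvK //; move: xU; rewrite inU => /andP[].
have p'U x : x \in U -> p' x \in S by rewrite /p' => ->; rewrite -hS codom_f.
have p'nU x : x \notin U -> p' x \notin U.
  move=> xU; rewrite /p' (negPf xU); have [xr|xr] := eqVneq x r.
    by rewrite xr (parent_root pm) -xr.
  by rewrite inU negb_and (pU x) ?orbT.
have pm' : parent_map e' r p' d'.
  split=> //.
    by rewrite /p'; case: ifP => [/Ur|_]; rewrite ?eqxx ?(parent_root pm).
  move=> x xr; rewrite /d'; have [xU|xU] := boolP (x \in U); last first.
    by rewrite (negPf (p'nU _ xU)) /p' (negPf xU) (parent_rank pm).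
  have ip := parent_rank pms (hinvU x xU).
  rewrite /p' xU hU hK; case: ifP => [_|/negbFE/eqP ->].
    by rewrite ltn_add2l.
  by rewrite hr addSn ltnS leq_addr.
have te' := parent_map_tree pm'.
(* Ancestors of a vertex form a chain, so outside [U] all vertices of [S] have the same ancestors as
   [v]. Rewiring inside [S] therefore leaves ancestry by vertices outside [U] unchanged. *)
have toS u z : u \in S -> z \notin U -> fconnect p u z = fconnect p v z.
  rewrite inS => uv zU; apply/idP/idP => [uz|]; last exact: connect_trans uv.
  case/orP: (fconnect_linear uv uz) => // zv.
  by move: zU; rewrite inU inS zv andbT negbK => /eqP->.
have outU u z : z \notin U -> fconnect p' u z = fconnect p u z.
  move=> zU; have [n] := ubnP (d' u); elim: n u => // n IH u /ltnSE du.
  have [->|ur] := eqVneq u r; first by rewrite (fconnect_fromr pm') (fconnect_fromr pm).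
  rewrite fconnect_parent IH; last by apply: leq_trans (parent_rank pm' ur) _.
  have [uU|uU] := boolP (u \in U); last by rewrite /p' (negPf uU) -fconnect_parent.
  have -> : (u == z) = false by apply: contraTF uU => /eqP->.
  by rewrite /= !toS //; [move: uU; rewrite inU => /andP[]|apply: p'U].
have toU u z : z \in U -> fconnect p' u z -> u \in U.
  move=> zU /iter_findex E; apply: contraTT zU => uU; rewrite -E.
  by elim: (findex _ _ _) => //= n; apply: p'nU.
have vU : v \notin U by rewrite inU eqxx.
have belowE z : z \notin U -> below e' r z = below e r z.
  move=> zU; apply/setP => u.
  by rewrite !mem_below (mem_lineage pm') // (mem_lineage pm) // outU.
exists e'; split.
- exact: te'.
- exists h; split=> //; first by rewrite belowE.
  (* At the root of [s] both sides are false: its image [v] is either [r] or has its parent outside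
     [S]. *)
  have adjU i j : (h i != r) && (p' (h i) == h j) = (i != Defs.root s) && (ps i == j).
    have [->|ir] := eqVneq i (Defs.root s).
      rewrite hr /p' (negPf vU) /=; have [//|vr /=] := eqVneq v r.
      by apply: contraNF (pU v vr vU) => /eqP->; rewrite -hS codom_f.
    have iU : h i \in U by rewrite hU.
    by rewrite (Ur _ iU) /p' iU hK (inj_eq hi).
  by move=> i j; rewrite /e' !adjU (parent_adj pms).
- by move=> x y; rewrite !nU => xU yU; rewrite /e' /p' (negPf xU) (negPf yU) (parent_adj pm).
- by move=> z; rewrite nU => /belowE.
move=> z zU; split; apply/properP; split.
- apply/fintype.subsetP => u; rewrite mem_below (mem_lineage pm') // => /(toU _ _ zU).
  by rewrite inU => /andP[].
- exists v => //; rewrite mem_below (mem_lineage pm') //.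
  by apply: contra vU; apply: toU.
- apply/fintype.subsetP => u; rewrite mem_below (mem_lineage pm) // inS => uz.
  by apply: connect_trans uz _; move: zU; rewrite inU inS => /andP[].
exists v => //; rewrite mem_below (mem_lineage pm) //; apply/negP => vz.
have := zU; rewrite inU inS => /andP[zv zv'].
move: vz; rewrite fconnect_parent eq_sym (negPf zv) /= => vz.
have [vr|vr] := eqVneq v r; last first.
  by have := fconnect_parentF pm vr; rewrite (connect_trans vz zv').
by move: vz; rewrite vr (parent_root pm) (fconnect_fromr pm) -vr (negPf zv).
Qed.

End grafting.

(** * Counting and replacing subtrees *)

Section subtrees.
Variables (t : ltree).
Local Notation e := (@adj t).
Local Notation r := (Defs.root t).

Lemma iso_classP (s : ltree) (u : rtree) : iso_class s = u <-> ltree_iso (rep u) s.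
Proof.
have E : iso_class (rep u) = u by apply: reprK.
rewrite ltree_iso_sym -{1}E; split=> [/eqquotP|h] //.
exact/eqquotP.
Qed.

Lemma subtree_atP (v : 'I_(nvert t)) (u : rtree) :
  subtree_at v = u <-> branch e (below e r v) v (rep u).
Proof.
rewrite iso_classP; split.
  move=> /asboolP[f [[g fK gK] fe fr]].
  pose h i := val (enum_val (f i)); exists h; split.
  - by move=> i j /val_inj/enum_val_inj/(can_inj fK).
  - move=> x; apply/codomP/idP => [[i ->]|xS]; first exact: valP (enum_val (f i)).
    exists (g (enum_rank (exist (fun x => is_true (x \in _)) x xS))).
    by rewrite /h gK enum_rankK.
  - by rewrite /h fr enum_rankK.
  - by move=> i j; rewrite -fe.
move=> B; have cB := card_branch B; case: B => h [hi hS hr ha].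
have hin i : h i \in below e r v by rewrite -hS codom_f.
apply/asboolP.
exists (fun i => enum_rank (exist (fun x => is_true (x \in _)) (h i) (hin i))); split.
- apply: inj_card_bij; first by move=> i j /enum_rank_inj[/hi].
  by rewrite !card_ord /= card_sig -cB; apply/eq_leq/eq_card.
- by move=> i j; rewrite -ha /= !enum_rankK.
- by apply/(can_inj enum_valK)/val_inj; rewrite !enum_rankK.
Qed.

End subtrees.

(** This is N(t), with [u] in the role of t1. *)
Definition subtree_count (t : ltree) (u : rtree) : nat :=
  #|branches (@adj t) (Defs.root t) (rep u)|.

Section replace.
Variables (t1 t2 : rtree).
Hypotheses (t12 : t1 <> t2) (n12 : num_vertices t1 = num_vertices t2).

(** After grafting at [v], the copy at [v] is lost since the trees differ. Subtrees strictly below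
    [v] are too small to be copies, those strictly above too large, both before and after; all
    others are untouched. *)
Lemma replace_subtree (t : ltree) : (0 < subtree_count t t1)%N ->
  exists t', replacement t1 t2 t t' /\ (subtree_count t' t1).+1 = subtree_count t t1.
Proof.
case: t => n e r te; rewrite /subtree_count /= => /card_gt0P[v vB].
have /branchesP bv := vB; have cS := card_branch bv.
have [e' [te' bv' e'e below'e belowU]] := graft te (etrans cS n12).
set S := below e r v in cS bv e'e below'e belowU.
have vA : v \in v |: ~: S by rewrite finset.setU11.
exists (LTree r te'); split.
  (* The graft keeps the vertex set, so the identity matches what remains of the two trees. *)
  exists v, v, id; split; split=> //=.
  - exact/subtree_atP.
  - exact/subtree_atP.
  - by rewrite imset_id -/S below'e.
rewrite /= (cardsD1 v (branches e r _)) vB add1n; congr _.+1.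
apply: eq_card => z; rewrite finset.in_setD1.
have [->|zv] /= := eqVneq z v.
  apply/negP => /branchesP b1; apply: t12.
  by have <- : @subtree_at (LTree r te') v = t1; [apply/subtree_atP|apply/subtree_atP].
have [p [d pm]] := tree_parent_map r te.
have [zU|] := boolP (z \in S :\ v).
  have [/proper_card c1 /proper_card c2] := belowU z zU.
  by apply/branchesP/branchesP => /card_branch cz; move: c1 c2; rewrite cz cS ltnn.
rewrite finset.in_setD1 zv /= => zS.
have zA : z \in v |: ~: S by rewrite finset.in_setU1 finset.in_setC zS orbT.
have inb u w : (u \in below e r w) = fconnect p u w by rewrite mem_below (mem_lineage pm).
apply: (sameP (branchesP _ _ _ _)); apply: (equivP (branchesP _ _ _ _)).
rewrite below'e //; have [vz|vz] := boolP (v \in below e r z).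
  suff /proper_card c : S \proper below e r z.
    by split=> /card_branch cz; move: c; rewrite cz cS ltnn.
  apply/properP; split; last by exists z => //; rewrite inb.
  by apply/fintype.subsetP => u; rewrite !inb in vz *; move=> uv; apply: connect_trans uv vz.
have sub : {subset below e r z <= v |: ~: S}.
  move=> u uz; rewrite finset.in_setU1 finset.in_setC; apply/orP; right.
  move: uz vz zS; rewrite !inb => uz vz; apply: contra => uv.
  by case/orP: (fconnect_linear uz uv) => // h; rewrite h in vz.
by split; apply: eq_branch => x y /sub xA /sub yA; rewrite e'e.
Qed.

End replace.

(** The count drops by two, whereas a graph isomorphism amounts to a change of root, which can make
    up for a drop of one only. *)
Lemma shares_spectrum_count (t1 t2 t : rtree) : exchange_property t1 t2 ->
  (1 < subtree_count (rep t) t1)%N -> shares_spectrum t.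
Proof.
move=> [t12 n12 ex] c2.
have [t' [rt' c']] := replace_subtree t12 n12 (ltnW c2).
have [|t'' [rt'' c'']] := @replace_subtree _ _ t12 n12 t'; first by rewrite -ltnS c'.
exists (nvert t''), (@adj t''); split; first exact: adj_tree.
- move=> [f bf fe].
  have [g fK gK] := bf.
  have ge x y : adj (g x) (g y) = @adj (rep t) x y by rewrite -fe !gK.
  have bg : bijective g by exists f.
  have := card_branches_iso (f (Defs.root t'')) (rep t1) (adj_tree _) (adj_tree _) bg ge.
  have := card_branches_reroot (Defs.root (rep t)) (f (Defs.root t'')) (rep t1) (adj_tree (rep t)).
  rewrite fK => h1 h2.
  have := leq_trans h1 (h2 : (_.+1 <= _.+1)%N).
  by rewrite -/(subtree_count _ _) -/(subtree_count _ _) -c' -c'' ltnn.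
- by move=> a; rewrite -(ex _ _ rt'') -(ex _ _ rt').
Qed.

(** * Weak continuity of the mass of a clopen set *)

Section clopen_mass.
Variables (R : realType) (S : ptopologicalType) (A : set S).
Hypothesis clA : clopen A.

Lemma clopen_indic_continuous : continuous (\1_A : S -> R).
Proof.
move=> x; have [oA cA] := clA; apply: cvg_near_cst.
have [Ax|nAx] := pselect (A x).
  have : nbhs x A by apply: open_nbhs_nbhs.
  by apply: filterS => y Ay; rewrite !indicE !mem_set.
have : nbhs x (~` A) by apply: open_nbhs_nbhs; split=> //; rewrite openC.
by apply: filterS => y nAy; rewrite !indicE !memNset.
Qed.

Lemma indic_bounded : bounded_fun (\1_A : S -> R).
Proof.
exists 1; split=> // x x1 y _ /=; rewrite indicE; apply: le_trans (ltW x1).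
by case: (_ \in _); rewrite ?normr1 ?normr0.
Qed.

(** The indicator of [A] is itself a bounded continuous test function, so this mass is a coordinate
    of [integrate]. *)
Lemma clopen_mass_continuous :
  continuous (fun mu : weak_probability R S => fine (mu (A : set (borel S)))).
Proof.
have [oA _] := clA; have mA : measurable (A : set (borel S)) by apply: sub_sigma_algebra.
pose f : test_function R S := exist _ _ (conj clopen_indic_continuous indic_bounded).
have -> : (fun mu : weak_probability R S => fine (mu (A : set (borel S)))) =
    (fun g : prod_topology (fun _ : test_function R S => R) => g f : R) \o @integrate R S.
  by apply/funext => mu; rewrite /= /integrate /Rintegral /= integral_indic // setIT.
move=> mu; apply: (@continuous_comp (weak_probability R S)
  (prod_topology (fun _ : test_function R S => R)) R); first exact: initial_continuous.
exact: (@proj_continuous {classic test_function R S} (fun=> R) f).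
Qed.

End clopen_mass.

(** * Coordinates of fringe sequences and their masses *)

Lemma star_coordinate_clopen (k : nat) (a : rtree_star) :
  clopen [set s : star_seq | s k = a].
Proof.
have pc : continuous (fun s : star_seq => s k : rtree_star).
  exact: (@proj_continuous nat (fun=> rtree_star) k).
apply: (preimage_clopen (A := [set a]) _ pc).
by split; [exact: discrete_open|exact: discrete_closed].
Qed.

Lemma measurable_fun_rtree d (T : measurableType d) (g : rtree -> T) :
  measurable_fun [set: borel rtree] (g : borel rtree -> T).
Proof.
by move=> _ Y _; apply: sub_sigma_algebra; exact: discrete_open.
Qed.

Lemma fringe_seq0 (t : ltree) (v : 'I_(nvert t)) : fringe_seq v 0%N = Some (subtree_at v).
Proof.
rewrite /fringe_seq insubT /=; congr Some; rewrite /subtree_at; congr fringe_tree.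
exact: val_inj.
Qed.

Lemma fringe_seq1_root (t : ltree) : fringe_seq (Defs.root t) 1%N = None.
Proof.
by rewrite /fringe_seq insubF // /depth (root_pathE (adj_tree t) (p := [::])).
Qed.

Lemma Phi_subtree_mass (R : realType) (t u : rtree) :
  (subtree_count (rep t) u <= 1)%N ->
  (Phi R t [set s : borel star_seq | (s : star_seq) 0%N = Some u] <=
   Phi R t [set s : borel star_seq | (s : star_seq) 1%N = None])%E.
Proof.
move=> c1; rewrite /Phi lee_pmul2l //; last first.
  by rewrite lte_fin invr_gt0 ltr0n (leq_trans _ (ltn_ord (Defs.root (rep t)))).
(* Without the factor 1/#t, the left side counts copies of [u], at most one, and the right side
   contains the unit atom of the root. *)
apply: (@le_trans _ _ 1%E).
  rewrite (eq_bigr (fun v => ((v \in branches (@adj (rep t)) (Defs.root (rep t)) (rep u))%:R)%:E)).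
    rewrite sumEFin lee_fin -natr_sum lern1 (leq_trans _ c1) // /subtree_count.
    by rewrite -sum1_card [leqRHS]big_mkcond /=; apply: leq_sum => v _; case: ifP.
  move=> v _; rewrite diracE; congr ((nat_of_bool _)%:R%:E); apply/idP/idP.
    by rewrite inE /= fringe_seq0 => -[/subtree_atP ?]; apply/branchesP.
  by move=> /branchesP/subtree_atP E; rewrite inE /= fringe_seq0 E.
rewrite (bigD1 (Defs.root (rep t))) //= diracE mem_set /= ?fringe_seq1_root //.
by rewrite leeDl // sume_ge0.
Qed.

Theorem proposition4p8 (R : realType)
  (d : nat -> measure_display) (Omega : forall n : nat, measurableType (d n))
  (P : forall n : nat, probability (Omega n) R)
  (T : forall n : nat, {RV (P n) >-> borel rtree})
  (d' : measure_display) (Omega' : measurableType d')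
  (P' : probability Omega' R) (X : {RV P' >-> borel sin_tree})
  (t1 t2 : rtree) :
  fringe_cvg T X ->
  exchange_property t1 t2 ->
  (0 < P' [set w | (X w : sin_tree) 0%N = t1])%E ->
  (fun n => P n [set w | shares_spectrum (T n w)]) @ \oo --> 1%E.
Proof.
move=> cvgT ex p0.
pose A := [set s : star_seq | s 0%N = Some t1].
pose B := [set s : star_seq | s 1%N = None].
have clA : clopen A by apply: star_coordinate_clopen.
have clB : clopen B by apply: star_coordinate_clopen.
have lawA : sin_law X A = P' [set w | (X w : sin_tree) 0%N = t1].
  by congr (P' _); apply/seteqP; split => w; [case|rewrite /A /= /sin_embed /= => <-].
(* A sin-tree has no star coordinate. *)
have lawB : sin_law X B = 0%E.
  by rewrite -(measure0 P'); congr (P' _); apply/seteqP; split.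
have mA : measurable (A : set (borel star_seq)) by apply: sub_sigma_algebra; case: clA.
have mB : measurable (B : set (borel star_seq)) by apply: sub_sigma_algebra; case: clB.
pose c := fine (sin_law X A).
have c0 : 0 < c.
  by rewrite fine_gt0 // lawA p0 /= -lawA (le_lt_trans (probability_le1 _ mA)) ?ltry.
pose m (D : set star_seq) (mu : weak_probability R star_seq) : R :=
  fine (mu (D : set (borel star_seq))).
(* Division by [c] gives the value 1 at the limit law. Clipping to [0, 1] then makes [F] a bounded
   continuous function that is 1 there and can lie below an indicator. *)
pose G mu : R := (m A mu - m B mu) / c.
pose F mu : R := Num.min 1 (Num.max 0 (G mu)).
have cG : continuous G.
  move=> mu; apply: (@continuousM _ _ (m A - m B) (fun=> c^-1)); last exact: cst_continuous.
  by apply: continuousB; apply: clopen_mass_continuous.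
have cF : continuous F.
  apply: min_fun_continuous; first exact: cst_continuous.
  by apply: max_fun_continuous => //; exact: cst_continuous.
have F01 mu : 0 <= F mu <= 1.
  by rewrite /F le_min ler01 le_max lexx ge_min lexx.
have bF : bounded_fun F.
  exists 1; split=> // x x1 mu _ /=; have /andP[F0 F1] := F01 mu.
  by rewrite ger0_norm // (le_trans F1) // ltW.
have Flim : F (sin_law X) = 1.
  have mlA : m A (sin_law X) = c by [].
  have mlB : m B (sin_law X) = 0 by exact: (congr1 fine lawB).
  by rewrite /F /G mlA mlB subr0 divff ?gt_eqF // max_r ?ler01 // minxx.
have := cvgT F cF bF; rewrite Flim => EF.
pose Sh n := [set w | shares_spectrum (T n w)].
have mSh n : measurable (Sh n).
  rewrite -[Sh n]setTI; apply: (measurable_funPT (T n)) => //.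
  by apply: sub_sigma_algebra; exact: discrete_open.
have PSh n : P n (Sh n) = (fine (P n (Sh n)))%:E by rewrite fineK // fin_num_measure.
have le1 n : fine (P n (Sh n)) <= 1.
  by rewrite -lee_fin -PSh probability_le1.
(* If the spectrum is not shared, there is at most one copy of [t1], so [A] has no more mass than
   [B] and [F] vanishes. *)
have FSh n w : F (Phi R (T n w)) <= \1_(Sh n) w.
  have [sh|nsh] := pselect (shares_spectrum (T n w)).
    by rewrite indicE mem_set //; case/andP: (F01 (Phi R (T n w))).
  rewrite indicE memNset //.
  have PAB : (Phi R (T n w) A <= Phi R (T n w) B)%E.
    apply: Phi_subtree_mass; rewrite leqNgt; apply/negP => c2; apply: nsh.
    exact: shares_spectrum_count ex c2.
  rewrite /F /G max_l ?ge_min ?lexx ?orbT // ler_pdivrMr // mul0r subr_le0.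
  by rewrite fine_le // fin_num_measure.
have leF n : \int[P n]_w F (Phi R (T n w)) <= fine (P n (Sh n)).
  have -> : fine (P n (Sh n)) = \int[P n]_w \1_(Sh n) w.
    by rewrite /Rintegral /= integral_indic // setIT.
  apply: le_Rintegral => //; last exact: integrable_indic.
  apply: measurable_bounded_integrable => //.
  - by apply: le_lt_trans (probability_le1 _ _) _; rewrite ?ltry.
  - apply: (@measurableT_comp _ _ _ (Omega n) (borel rtree) R
      (fun t : rtree => F (Phi R t)) _ (T n)); last exact: measurable_funPT.
    exact: measurable_fun_rtree.
  - exists 1; split=> // x x1 w _ /=; have /andP[F0 F1] := F01 (Phi R (T n w)).
    by rewrite ger0_norm // (le_trans F1) // ltW.
(* The probability lies between the expectation of [F], which tends to 1, and 1. *)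
have fP : fine (P n (Sh n)) @[n --> \oo] --> (1 : R).
  apply: (squeeze_cvgr (h := fun=> 1) _ EF); last exact: cvg_cst.
  by apply: nearW => n; rewrite leF le1.
apply: cvg_EFin; last exact: fP.
by apply: nearW => n; rewrite -/(Sh n) PSh.
Qed.
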